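(* Let $A,B$ be finite sets with $A\cap B=\emptyset$. (a) For partial orders $\mathcal{R}$ on $A$ and $\mathcal{Q}$ on $B$, $\lambda\in\mathrm{pp}_{\mathrm{nn}}(\mathcal{R})$ and $\nu\in\mathrm{pp}_{\mathrm{nn}}(\mathcal{Q})$, $$\mathrm{Inf}_{A,B}(\chi^\lambda\otimes\chi^\nu)=\chi^{\lambda\cup\nu},$$ where $\lambda\cup\nu\in\mathrm{pp}_{\mathrm{nn}}(\mathcal{R}.\mathcal{Q})$. (b) For a partial order $\mathcal{R}$ on $A\cup B$ and $\lambda\in\mathrm{pp}_{\mathrm{nn}}(\mathcal{R})$, $$\mathrm{Res}_{A,B}(\chi^\lambda)=\frac{|\mathrm{UT}_\lambda\cap(\mathrm{UT}_{\mathcal{R}|_A}\times\mathrm{UT}_{\mathcal{R}|_B})|}{|\mathrm{UT}_{\lambda_A}\times\mathrm{UT}_{\lambda_B}|}\,\frac{\chi^\lambda(1)}{\chi^{\lambda_A\cup\lambda_B}(1)}\sum_{\substack{\nu\in\mathrm{Anti}(\mathrm{Int}^\lambda_{\lambda_A})\\ \eta\in\mathrm{Anti}(\mathrm{Int}^\lambda_{\lambda_B})}}\chi^{\lambda_A\cup\nu}\otimes\chi^{\lambda_B\cup\eta}.$$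
   Context: Fix a finite field $\mathbb{F}_q$ with $q$ elements. For a partial order $\mathcal{R}$ on a finite set $A$, $\mathrm{Int}^\circ(\mathcal{R})=\{[i,j]\mid i\prec_{\mathcal{R}}j\}$, ordered by $[k,l]\preceq[i,j]$ iff $i\preceq_{\mathcal{R}}k$ and $l\preceq_{\mathcal{R}}j$; intervals are identified with pairs of endpoints. The pattern group is $\mathrm{UT}_{\mathcal{R}}=\{u:\{[i,j]\mid i\preceq_{\mathcal{R}}j\}\to\mathbb{F}_q\mid u([i,i])=1\}$ with product $(uv)([i,k])=\sum_{i\preceq_{\mathcal{R}}j\preceq_{\mathcal{R}}k}u([i,j])v([j,k])$. A subposet $\mathcal{Q}$ of $\mathcal{R}$ is a partial order on $A$ with $i\preceq_{\mathcal{Q}}j\Rightarrow i\preceq_{\mathcal{R}}j$; $\mathrm{UT}_{\mathcal{Q}}\subseteq\mathrm{UT}_{\mathcal{R}}$ via extension by zero. $\mathrm{NPtt}(\mathcal{R})=\{\mathrm{UT}_{\mathcal{Q}}\triangleleft\mathrm{UT}_{\mathcal{R}}\mid\mathcal{Q}\text{ a subposet of }\mathcal{R}\}$, ordered by inclusion. $\mathrm{Anti}(\mathcal{P})$ is the set of antichains of a poset $\mathcal{P}$, and $\mathrm{pp}_{\mathrm{nn}}(\mathcal{R})=\mathrm{Anti}(\mathrm{Int}^\circ(\mathcal{R}))$. For $\lambda\in\mathrm{pp}_{\mathrm{nn}}(\mathcal{R})$: $\mathrm{UT}_\lambda\in\mathrm{NPtt}(\mathcal{R})$ is the subgroup of all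 $u\in\mathrm{UT}_{\mathcal{R}}$ with $u([k,l])=0$ whenever $[k,l]\preceq[i,j]$ for some $[i,j]\in\lambda$. $\chi^\lambda=\sum_\psi\psi(1)\psi$ over irreducible complex characters $\psi$ of $\mathrm{UT}_{\mathcal{R}}$ with $\mathrm{UT}_\lambda\subseteq\ker\psi$ and $O\not\subseteq\ker\psi$ for every cover $O$ of $\mathrm{UT}_\lambda$ in $\mathrm{NPtt}(\mathcal{R})$. For partial orders $\mathcal{P}$ on $A$, $\mathcal{Q}$ on $B$, $\mathcal{P}.\mathcal{Q}$ is the partial order on $A\cup B$ with $i\preceq_{\mathcal{P}.\mathcal{Q}}j$ iff $i\preceq_{\mathcal{P}}j$, or $i\preceq_{\mathcal{Q}}j$, or $i\in A$ and $j\in B$. $\mathcal{R}|_A$ denotes restriction of a partial order to $A$. $\mathrm{Inf}_{A,B}(\phi\otimes\psi)$ is the function on $\mathrm{UT}_{\mathcal{P}.\mathcal{Q}}$ given by $u\mapsto\phi(u_A)\psi(u_B)$, where $u_A,u_B$ are the restrictions of $u$ to intervals with both endpoints in $A$, resp. $B$. For $\mathcal{R}$ on $A\cup B$ and a function $\psi$ on $\mathrm{UT}_{\mathcal{R}}$, $\mathrm{Res}_{A,B}(\psi)$ is the function on $\mathrm{UT}_{\mathcal{R}|_A}\times\mathrm{UT}_{\mathcal{R}|_B}$ given by $(u,v)\mapsto\psi(\iota_{A,B}(u,v))$, where $\iota_{A,B}(u,v)([i,j])$ equals $u([i,j])$ if $i,j\in A$, $v([i,j])$ if $i,j\in B$,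 and $0$ otherwise; via $\iota_{A,B}$, $\mathrm{UT}_{\mathcal{R}|_A}\times\mathrm{UT}_{\mathcal{R}|_B}$ is a subgroup of $\mathrm{UT}_{\mathcal{R}}$. Functions on a product $G\times H$ are identified with elements of the tensor product. In (b): $\lambda_A=\{[i,j]\in\lambda\mid i,j\in A\}\in\mathrm{pp}_{\mathrm{nn}}(\mathcal{R}|_A)$, similarly $\lambda_B$; $\mathrm{UT}_{\lambda_A}\subseteq\mathrm{UT}_{\mathcal{R}|_A}$ and $\mathrm{UT}_{\lambda_B}\subseteq\mathrm{UT}_{\mathcal{R}|_B}$ are formed with respect to $\mathcal{R}|_A$ and $\mathcal{R}|_B$, as are the characters $\chi^{\lambda_A\cup\nu}$, $\chi^{\lambda_B\cup\eta}$. $\chi^{\lambda_A\cup\lambda_B}$ is the supercharacter of $\mathrm{UT}_{\mathcal{R}|_A}\times\mathrm{UT}_{\mathcal{R}|_B}$ (the pattern group of the disjoint union of $\mathcal{R}|_A$ and $\mathcal{R}|_B$) indexed by $\lambda_A\cup\lambda_B$. $\mathrm{Int}^\lambda_{\lambda_A}$ is the set of $[i,j]\in\mathrm{Int}^\circ(\mathcal{R}|_A)$ with $[i,j]\not\preceq_{\mathrm{Int}^\circ(\mathcal{R}|_A)}[k,l]$ for all $[k,l]\in\lambda_A$ and $[i,j]\preceq_{\mathrm{Int}^\circ(\mathcal{R})}[k,l]$ for some $[k,l]\in\lambda$, with order induced from $\mathrm{Int}^\circ(\mathcal{R}|_A)$; $\mathrm{Int}^\lambda_{\lambda_B}$ is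 defined in the same way with $B$. *)

(* Defs.v *)
From HB Require Import structures.
From mathcomp Require Import all_boot all_order all_fingroup all_algebra all_field.
From mathcomp Require Import all_character.

Set Implicit Arguments.
Unset Strict Implicit.
Unset Printing Implicit Defensive.

Import GRing.Theory.
Local Open Scope ring_scope.

(* Partial orders on a finite type, encoded by their graphs so that the
   partial orders on T form a finType. *)
Section PartialOrders.
Variable T : finType.

Definition porder_axiom (E : {set T * T}) : bool :=
  [&& [forall x, (x, x) \in E],
      [forall x, forall y, ((x, y) \in E) && ((y, x) \in E) ==> (x == y)]
    & [forall x, forall y, forall z,
         ((x, y) \in E) && ((y, z) \in E) ==> ((x, z) \in E)]].

Record porder := POrder { graph : {set T * T}; _ : porder_axiom graph }.

HB.instance Definition _ := [isSub for graph].
HB.instance Definition _ := [Finite of porder by <:].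

Definition po_rel (R : porder) : rel T := fun x y => (x, y) \in graph R.
Coercion po_rel : porder >-> rel.

Lemma po_refl (R : porder) : reflexive R.
Proof.
move=> x; case: R => E hE; have /and3P [/forallP h _ _] := hE; exact: h.
Qed.

Lemma po_anti (R : porder) : antisymmetric R.
Proof.
move=> x y h; apply/eqP; move: h; apply/implyP.
by case: R => E hE; have /and3P [_ /forallP h _] := hE; apply: (forallP (h x)).
Qed.

Lemma po_trans (R : porder) : transitive R.
Proof.
move=> y x z hxy hyz.
have: R x y && R y z by rewrite hxy.
apply/implyP; case: R {hxy hyz} => E hE; have /and3P [_ _ /forallP h] := hE.
exact: (forallP (forallP (h x) y)).
Qed.

Lemma porder_axiomP (r : rel T) :
  reflexive r -> antisymmetric r -> transitive r ->
  porder_axiom [set p | r p.1 p.2].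
Proof.
move=> rr ra rt; apply/and3P; split.
- by apply/forallP => x; rewrite inE rr.
- apply/forallP => x; apply/forallP => y; rewrite !inE /=.
  by apply/implyP => /ra ->.
- apply/forallP => x; apply/forallP => y; apply/forallP => z; rewrite !inE /=.
  by apply/implyP => /andP [h1 h2]; apply: rt h2.
Qed.

Definition porder_of (r : rel T) (rr : reflexive r) (ra : antisymmetric r)
  (rt : transitive r) : porder := POrder (porder_axiomP rr ra rt).

Lemma porder_ofE r rr ra rt : @porder_of r rr ra rt =2 r.
Proof. by move=> x y; rewrite /po_rel inE. Qed.

Definition subposet (Q R : porder) : bool :=
  [forall x, forall y, Q x y ==> R x y].

End PartialOrders.

(* The interval [i,j] is the pair (i, j). *)
Definition Int0 (T : finType) (R : porder T) : {set T * T} :=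
  [set p | R p.1 p.2 && (p.1 != p.2)].

(* [k,l] <= [i,j] for p = [k,l] and q = [i,j]; this is the order of Int0 R only
   when both p and q belong to Int0 R. *)
Definition int_le (T : finType) (R : porder T) : rel (T * T) :=
  fun p q => R q.1 p.1 && R p.2 q.2.

Definition Anti (T : finType) (le : rel T) (S : {set T}) : {set {set T}} :=
  [set X : {set T} | (X \subset S) &&
     [forall x in X, forall y in X, le x y ==> (x == y)]].

Definition pp_nn (T : finType) (R : porder T) : {set {set T * T}} :=
  Anti (int_le R) (Int0 R).

(* Pattern groups. A function on {[i,j] | i <=_R j} is encoded by its extension
   by zero to all pairs. *)
Section PatternGroup.
Variables (F : finFieldType) (T : finType) (R : porder T).

Definition UT_axiom (f : {ffun T * T -> F}) : bool :=
  [forall i, f (i, i) == 1] && [forall p, ~~ R p.1 p.2 ==> (f p == 0)].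

Record UT := MkUT { ut_val :> {ffun T * T -> F}; _ : UT_axiom ut_val }.

HB.instance Definition _ := [isSub for ut_val].
HB.instance Definition _ := [Finite of UT by <:].

Implicit Types u v w : UT.

Lemma UT_diag u i : u (i, i) = 1.
Proof. by case: u => f hf; have /andP [/forallP h _] := hf; apply/eqP/h. Qed.

Lemma UT_out u i j : ~~ R i j -> u (i, j) = 0.
Proof.
move=> nR; case: u => f hf; have /andP [_ /forallP h] := hf.
exact/eqP/(implyP (h (i, j))).
Qed.

Lemma UT_axiomP (f : {ffun T * T -> F}) :
  (forall i, f (i, i) = 1) -> (forall i j, ~~ R i j -> f (i, j) = 0) ->
  UT_axiom f.
Proof.
move=> h1 h0; apply/andP; split; first by apply/forallP => i; rewrite h1.
by apply/forallP => -[i j]; apply/implyP => /h0 ->.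
Qed.

Lemma UT_eqP u v : (forall i j, R i j -> u (i, j) = v (i, j)) -> u = v.
Proof.
move=> h; apply/val_inj/ffunP => -[i j] /=.
by case: (boolP (R i j)) => [/h // | nR]; rewrite !UT_out.
Qed.

Definition ut_mul_fun u v : {ffun T * T -> F} :=
  [ffun p => \sum_(j | R p.1 j && R j p.2) u (p.1, j) * v (j, p.2)].

Definition ut_one_fun : {ffun T * T -> F} := [ffun p => (p.1 == p.2)%:R].

Lemma ut_mul_subproof u v : UT_axiom (ut_mul_fun u v).
Proof.
apply: UT_axiomP => [i | i k nR]; rewrite ffunE /=.
  rewrite (big_pred1 i) ?UT_diag ?mulr1 // => j.
  apply/idP/eqP => [/po_anti // | ->]; by rewrite !po_refl.
rewrite big_pred0 // => j; apply/negbTE; apply: contra nR => /andP [h1 h2].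
exact: po_trans h2.
Qed.

Lemma ut_one_subproof : UT_axiom ut_one_fun.
Proof.
apply: UT_axiomP => [i | i k nR]; rewrite ffunE /= ?eqxx //.
by case: eqP nR => // ->; rewrite po_refl.
Qed.

Definition ut_mul u v : UT := MkUT (ut_mul_subproof u v).
Definition ut_one : UT := MkUT ut_one_subproof.

Lemma ut_mulE u v i k :
  ut_mul u v (i, k) = \sum_j u (i, j) * v (j, k).
Proof.
rewrite ffunE /= big_mkcond; apply: eq_bigr => j _.
case: ifP => // /negbT; rewrite negb_and => /orP [] /UT_out ->.
  by rewrite mul0r.
by rewrite mulr0.
Qed.

Lemma ut_mulA : associative ut_mul.
Proof.
move=> u v w; apply: UT_eqP => i k _; rewrite !ut_mulE.
under eq_bigr => j _ do rewrite ut_mulE big_distrr.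
rewrite exchange_big; apply: eq_bigr => l _ /=.
rewrite ut_mulE big_distrl; by apply: eq_bigr => j _; rewrite mulrA.
Qed.

Lemma ut_mul1 : left_id ut_one ut_mul.
Proof.
move=> u; apply: UT_eqP => i k _; rewrite ut_mulE (bigD1 i) //=.
rewrite big1 ?addr0 ?ffunE /= ?eqxx ?mul1r // => j /negbTE hj.
by rewrite ffunE /= eq_sym hj mul0r.
Qed.

Lemma ut_mulI u : injective (ut_mul^~ u).
Proof.
move=> v w /= e; apply: UT_eqP => i k _.
move: {2}#|_| (leqnn #|[set j | R j k]|) => n.
elim: n k => [|n IHn] k.
  rewrite leqn0 cards_eq0 => /eqP /setP /(_ k); by rewrite !inE po_refl.
move=> le_n; have := congr1 (fun x : UT => x (i, k)) e.
rewrite !ut_mulE (bigD1 k) //= [RHS](bigD1 k) //= !UT_diag !mulr1.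
rewrite [X in _ + X = _](_ : _ = \sum_(j | j != k) w (i, j) * u (j, k)).
  exact: addIr.
apply: eq_bigr => j nejk; case: (boolP (R j k)) => [Rjk | /UT_out ->].
  congr (_ * _); apply: IHn; rewrite -ltnS; apply: leq_trans le_n.
  apply: proper_card; apply/properP; split.
    by apply/subsetP => l; rewrite !inE => /po_trans; apply.
  exists k; rewrite !inE ?po_refl //; apply: contra nejk => Rkj.
  by apply/eqP; apply: (@po_anti _ R); rewrite Rjk.
by rewrite !mulr0.
Qed.

Definition ut_inv u : UT := invF (@ut_mulI u) ut_one.

Lemma ut_mulV : left_inverse ut_one ut_inv ut_mul.
Proof. by move=> u; apply: (f_invF (@ut_mulI u)). Qed.

HB.instance Definition _ :=
  Finite_isGroup.Build UT ut_mulA ut_mul1 ut_mulV.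

End PatternGroup.

Section Supercharacters.
Variables (F : finFieldType) (T : finType) (R : porder T).

(* With functions extended by zero, the embedding of UT_Q in UT_R, for Q a
   subposet of R, is the identity on the underlying functions. *)
Definition UT_sub (Q : porder T) : {set UT F R} :=
  [set u : UT F R | UT_axiom Q (ut_val u)].

Definition NPtt : {set {set UT F R}} :=
  [set UT_sub Q | Q : porder T
     & subposet Q R && (UT_sub Q <| [set: UT F R])%g].

Definition NPtt_cover (H O : {set UT F R}) : bool :=
  [&& O \in NPtt, H \proper O
    & [forall K in NPtt, ~~ ((H \proper K) && (K \proper O))]].

(* p is restricted to Int0 R because every u takes the value 1 on [i,i]. *)
Definition UT_lam (lam : {set T * T}) : {set UT F R} :=
  [set u : UT F R |
     [forall p in Int0 R, [exists q in lam, int_le R p q] ==> (u p == 0)]].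

Definition chi (lam : {set T * T}) : 'CF([set: UT F R]) :=
  \sum_(i : Iirr [set: UT F R] |
          (UT_lam lam \subset cfker 'chi_i) &&
          [forall O : {set UT F R},
             NPtt_cover (UT_lam lam) O ==> ~~ (O \subset cfker 'chi_i)])
     'chi_i 1%g *: 'chi_i.

End Supercharacters.

(* The union of the disjoint sets A and B is the sum type A + B. *)
Section Unions.
Variables (A B : finType).

Definition inl2 (p : A * A) : (A + B) * (A + B) := (inl p.1, inl p.2).
Definition inr2 (p : B * B) : (A + B) * (A + B) := (inr p.1, inr p.2).

Definition unionAB (lam : {set A * A}) (nu : {set B * B}) :
  {set (A + B) * (A + B)} := (inl2 @: lam) :|: (inr2 @: nu).

Definition lamA (lam : {set (A + B) * (A + B)}) : {set A * A} :=
  inl2 @^-1: lam.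
Definition lamB (lam : {set (A + B) * (A + B)}) : {set B * B} :=
  inr2 @^-1: lam.

(* With b = true, the relation of P.Q; with b = false, that of the disjoint
   union of P and Q. *)
Definition union_rel (b : bool) (P : porder A) (Q : porder B) : rel (A + B) :=
  fun x y => match x, y with
    | inl i, inl j => P i j
    | inr i, inr j => Q i j
    | inl _, inr _ => b
    | inr _, inl _ => false
    end.

Section UnionOrder.
Variables (b : bool) (P : porder A) (Q : porder B).

Lemma union_rel_refl : reflexive (union_rel b P Q).
Proof. by case=> i; apply: po_refl. Qed.

Lemma union_rel_anti : antisymmetric (union_rel b P Q).
Proof.
by case=> i [] j //=; rewrite ?andbF // => /po_anti ->.
Qed.

Lemma union_rel_trans : transitive (union_rel b P Q).
Proof. by case=> j [] i [] k //=; apply: po_trans. Qed.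

Definition union_porder : porder (A + B)%type :=
  porder_of union_rel_refl union_rel_anti union_rel_trans.

End UnionOrder.

Definition concat (P : porder A) (Q : porder B) : porder (A + B)%type :=
  union_porder true P Q.
(* UT of disj P Q is UT_P x UT_Q. *)
Definition disj (P : porder A) (Q : porder B) : porder (A + B)%type :=
  union_porder false P Q.

End Unions.

Section Pullback.
Variables (S T : finType) (f : S -> T) (injf : injective f) (R : porder T).
Let r : rel S := fun x y => R (f x) (f y).

Lemma pullback_refl : reflexive r.
Proof. by move=> x; apply: po_refl. Qed.

Lemma pullback_anti : antisymmetric r.
Proof. by move=> x y /po_anti /injf. Qed.

Lemma pullback_trans : transitive r.
Proof. by move=> y x z; apply: po_trans. Qed.

Definition pullback : porder S :=
  porder_of pullback_refl pullback_anti pullback_trans.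
End Pullback.

Section Restriction.
Variables (A B : finType).

Lemma inl_injective : injective (@inl A B). Proof. by move=> x y []. Qed.
Lemma inr_injective : injective (@inr A B). Proof. by move=> x y []. Qed.

Definition resA (R : porder (A + B)%type) : porder A := pullback inl_injective R.
Definition resB (R : porder (A + B)%type) : porder B := pullback inr_injective R.

Definition IntA (R : porder (A + B)%type) (lam : {set (A + B) * (A + B)}) :
  {set A * A} :=
  [set p in Int0 (resA R) |
     [forall q in lamA lam, ~~ int_le (resA R) p q] &&
     [exists q in lam, int_le R (inl2 B p) q]].
Definition IntB (R : porder (A + B)%type) (lam : {set (A + B) * (A + B)}) :
  {set B * B} :=
  [set p in Int0 (resB R) |
     [forall q in lamB lam, ~~ int_le (resB R) p q] &&
     [exists q in lam, int_le R (inr2 A p) q]].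

End Restriction.

(* phi (x) psi as a function on the product *)
Definition tens (S T : Type) (phi : S -> algC) (psi : T -> algC) :
  S * T -> algC := fun p => phi p.1 * psi p.2.

Section InfRes.
Variables (F : finFieldType) (A B : finType).

Section Inflation.
Variables (P : porder A) (Q : porder B).

Lemma utA_subproof (u : UT F (concat P Q)) :
  UT_axiom P [ffun p : A * A => u (inl p.1, inl p.2)].
Proof.
apply: UT_axiomP => [i | i j nP]; rewrite ffunE /= ?UT_diag //.
by apply: UT_out; rewrite porder_ofE.
Qed.

Lemma utB_subproof (u : UT F (concat P Q)) :
  UT_axiom Q [ffun p : B * B => u (inr p.1, inr p.2)].
Proof.
apply: UT_axiomP => [i | i j nP]; rewrite ffunE /= ?UT_diag //.
by apply: UT_out; rewrite porder_ofE.
Qed.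

Definition utA (u : UT F (concat P Q)) : UT F P := MkUT (utA_subproof u).
Definition utB (u : UT F (concat P Q)) : UT F Q := MkUT (utB_subproof u).

Definition Inf (f : UT F P * UT F Q -> algC) : UT F (concat P Q) -> algC :=
  fun u => f (utA u, utB u).

End Inflation.

Section Restrict.
Variable R : porder (A + B)%type.

Definition iota_fun (p : UT F (resA R) * UT F (resB R)) :
  {ffun (A + B) * (A + B) -> F} :=
  [ffun x => match x with
    | (inl i, inl j) => p.1 (i, j)
    | (inr i, inr j) => p.2 (i, j)
    | _ => 0
    end].

Lemma iota_subproof p : UT_axiom R (iota_fun p).
Proof.
apply: UT_axiomP => [[i|i] | [i|i] [j|j] nR]; rewrite ffunE /= ?UT_diag //;
  by apply: UT_out; rewrite porder_ofE.
Qed.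

Definition iotaAB (p : UT F (resA R) * UT F (resB R)) : UT F R :=
  MkUT (iota_subproof p).

Definition Res (psi : UT F R -> algC) : UT F (resA R) * UT F (resB R) -> algC :=
  fun p => psi (iotaAB p).

End Restrict.
End InfRes.

(* Main.v *)
Require Import Defs.
From mathcomp Require Import all_boot all_order all_fingroup all_algebra all_field.
From mathcomp Require Import all_character.

Set Implicit Arguments.
Unset Strict Implicit.
Unset Printing Implicit Defensive.

Import GRing.Theory Num.Theory.
Local Open Scope ring_scope.

(* Normal pattern subgroups of UT_R are the groups [vanish D] of elements that
   vanish on a lower set [D] of the interval poset, and the covers of UT_lam are
   obtained by dropping one element of [lam] from the lower set [down lam] that
   [lam] generates. Inclusion-exclusion over these covers, with the regular
   characters of the quotients by [vanish D], gives
     chi^lam(u) = prod_(p in down lam) (q [u p = 0] - [p in lam]).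
   In (a) this product splits. In (b), the factors at mixed intervals are
   constant on the subgroup; on the intervals inside A, writing q [u p = 0] as
   (q [u p = 0] - 1) + 1 outside [down lam_A], expanding, and grouping the terms
   by the maximal elements of their index sets gives the sum over [nu]. *)

(** * Expansion of products, and sums of irreducible characters over a kernel condition *)

Lemma prodrD_subset (K : comNzRingType) (I : finType) (A : {set I}) (f g : I -> K) :
  \prod_(i in A) (f i + g i) =
  \sum_(J : {set I} | J \subset A)
     (\prod_(i in J) f i) * \prod_(i in A :\: J) g i.
Proof.
rewrite big_mkcond /=.
(* Outside [A] the factor 1 is written as 0 + 1, so that in the expansion over all subsets of [I]
   only those contained in [A] survive. *)
rewrite (eq_bigr (fun i => (if i \in A then f i else 0)
                         + (if i \in A then g i else 1))); last first.
  by move=> i _; case: ifP; rewrite ?add0r.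
rewrite bigA_distr (bigID (fun J : {set I} => J \subset A)) /=.
rewrite [X in _ + X]big1 ?addr0 => [|J /subsetPn[x xJ xA]]; last first.
  by rewrite (bigD1 x) //= xJ (negbTE xA) mul0r.
apply: eq_bigr => J sJA; rewrite (bigID (mem J)) /=; congr (_ * _).
  by apply: eq_bigr => i iJ; rewrite iJ (subsetP sJA).
rewrite big_mkcond [RHS]big_mkcond; apply: eq_bigr => i _.
by rewrite inE; case: (i \in J); case: (i \in A).
Qed.

(** The irreducible characters with [N] in their kernel are the inflations of those of [G / N], so
    the sum is the inflated regular character of [G / N]. *)
Lemma sum_irr_cfker (gT : finGroupType) (G N : {group gT}) : (N <| G)%g ->
  \sum_(i : Iirr G | N \subset cfker 'chi_i) 'chi_i 1%g *: 'chi_i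
    = #|G : N|%g%:R *: '1_N.
Proof.
move=> nsNG; apply/cfun_inP => x Gx.
rewrite sum_cfunE (reindex _ (mod_Iirr_bij nsNG)) /=.
transitivity (cfReg (G / N) (coset N x)).
  rewrite cfReg_sum sum_cfunE; apply: eq_big => [i | i _].
    by rewrite mod_IirrE ?cfker_mod.
  by rewrite !cfunE mod_IirrE // !cfModE // morph1.
rewrite cfRegE !cfunE cfuniE // card_quotient ?normal_norm // mulr_natr.
by rewrite (sameP eqP (kerP _ _)) ?ker_coset // (subsetP (normal_norm nsNG)).
Qed.

(** * Subgroups cut out by vanishing on a lower set of intervals *)

Section PatternSubgroups.
Variables (F : finFieldType) (T : finType) (R : porder T).
Implicit Types (u v w : UT F R) (p r : T * T) (D S lam : {set T * T}).

(** Order ideals of the interval poset. Since [int_le] compares arbitrary pairs, [p] has to be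
    confined to [Int0 R] explicitly. *)
Definition lower D :=
  D \subset Int0 R /\
  (forall p r, p \in Int0 R -> r \in D -> int_le R p r -> p \in D).

Definition down lam : {set T * T} :=
  [set p in Int0 R | [exists r in lam, int_le R p r]].

Definition vanish D : {set UT F R} := [set u : UT F R | [forall p in D, u p == 0]].

Lemma vanishP D u : reflect (forall p, p \in D -> u p = 0) (u \in vanish D).
Proof.
by rewrite inE; apply: (iffP forall_inP) => h p /h; [move/eqP | move->].
Qed.

Lemma UT_lamE lam : UT_lam F R lam = vanish (down lam).
Proof.
apply/setP => u; rewrite !inE; apply/forall_inP/forall_inP => h p.
  by rewrite inE => /andP[p0 ple]; apply: (implyP (h p p0)).
by move=> p0; apply/implyP => ple; apply: h; rewrite inE p0.
Qed.

Lemma UT_mulE u v i k : (u * v)%g (i, k) = \sum_j u (i, j) * v (j, k).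
Proof. exact: ut_mulE. Qed.

Lemma UT_1E i k : (1%g : UT F R) (i, k) = (i == k)%:R.
Proof. by rewrite ffunE. Qed.

(* Each [i,j] and [j,k] contributing to (u v)([i,k]) is trivial or lies below
   [i,k], so a product is determined on a lower set by its factors there. *)
Lemma UT_mul_agree D u u' v v' : lower D ->
  {in D, u =1 u'} -> {in D, v =1 v'} -> {in D, (u * v)%g =1 (u' * v')%g}.
Proof.
move=> [sD lD] uu' vv' [i k] Dik; rewrite !UT_mulE.
have eqD (x y : UT F R) a b : {in D, x =1 y} -> R i a -> R b k ->
    x (a, b) = y (a, b).
  move=> xy ia bk; have [-> | nab] := eqVneq a b; first by rewrite !UT_diag.
  have [ab | nRab] := boolP (R a b); last by rewrite !UT_out.
  by apply: xy; apply: lD Dik _; rewrite ?inE /int_le /= ?ab ?ia ?bk.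
apply: eq_bigr => j _.
have [ij | nij] := boolP (R i j); last by rewrite !(UT_out _ nij) !mul0r.
have [jk | njk] := boolP (R j k); last by rewrite !(UT_out _ njk) !mulr0.
by congr (_ * _); apply: eqD; rewrite ?po_refl.
Qed.

(** Vanishing on [D] becomes congruence to the identity on [D], which [UT_mul_agree] propagates
    through products and conjugates. *)
Lemma vanish_agree D u : lower D -> (u \in vanish D) <-> {in D, u =1 (1%g : UT F R)}.
Proof.
move=> [sD _]; split=> [/vanishP h | h].
  move=> [i k] Dik; rewrite h // UT_1E.
  by have := subsetP sD _ Dik; rewrite inE /= => /andP[_ /negbTE->].
apply/vanishP => -[i k] Dik; rewrite h // UT_1E.
by have := subsetP sD _ Dik; rewrite inE /= => /andP[_ /negbTE->].
Qed.

Lemma vanish_group_set D : lower D -> group_set (vanish D).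
Proof.
move=> lD; apply/group_setP; split; first exact/vanish_agree.
move=> u v /(vanish_agree _ lD) hu /(vanish_agree _ lD) hv.
by apply/(vanish_agree _ lD) => p Dp; rewrite (UT_mul_agree lD hu hv) ?mulg1.
Qed.

Lemma vanish_normal D : lower D -> (vanish D <| [set: UT F R])%g.
Proof.
move=> lD; have := vanish_group_set lD => gD.
have -> : vanish D = Group gD by [].
apply/fingroup.normalP; split; first exact: subsetT.
move=> x _; apply/eqP; rewrite eqEcard cardJg leqnn andbT.
apply/subsetP => _ /imsetP[u /(vanish_agree _ lD) hu ->].
apply/(vanish_agree _ lD) => p Dp; rewrite -(mulVg x).
(* As [u] agrees with 1 on [D], so does [u * x] with [x], and hence the conjugate with
   [x^-1 * x]. *)
have hux : {in D, (u * x)%g =1 x}.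
  by move=> r Dr; rewrite (@UT_mul_agree _ u 1%g x x lD) ?mul1g.
by rewrite (@UT_mul_agree _ x^-1%g x^-1%g (u * x)%g x lD).
Qed.

Lemma card_vanish D : D \subset Int0 R ->
  #|vanish D| = (#|F| ^ #|Int0 R :\: D|)%N.
Proof.
move=> sD; rewrite -(card_pffun_on (0 : F)).
(* Erasing the diagonal of ones identifies [vanish D] with the functions supported on
   [Int0 R :\: D]; [g] below restores the diagonal. *)
pose off (u : UT F R) := [ffun p : T * T => if p.1 == p.2 then 0 else u p].
have offI : injective off.
  move=> u v /ffunP e; apply: UT_eqP => i j _; have := e (i, j).
  by rewrite !ffunE /=; case: eqP => [-> | //]; rewrite !UT_diag.
rewrite -(card_imset _ offI); apply: eq_card => f.
apply/imsetP/pffun_onP => [[u /vanishP hu ->] | [/subsetP sf _]].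
  split=> //; apply/subsetP => -[i j]; rewrite !inE /off ffunE /=.
  case: (i =P j) => [_|_]; first by rewrite eqxx.
  case: (boolP ((i, j) \in D)) => [/hu-> | _]; first by rewrite eqxx.
  by rewrite andbT /=; apply: contraR => nR; rewrite UT_out.
have f0 p : p \notin Int0 R :\: D -> f p = 0.
  by move=> np; apply/eqP; apply: contraR np => /sf.
pose g := [ffun p : T * T => if p.1 == p.2 then 1 else f p].
have gU : UT_axiom R g.
  apply: UT_axiomP => [i | i j nR]; rewrite ffunE /= ?eqxx //.
  case: eqP => [ij|_]; first by rewrite ij po_refl in nR.
  by apply: f0; rewrite !inE /= (negbTE nR) andbF.
exists (MkUT gU).
  apply/vanishP => p Dp; rewrite /= ffunE.
  have := subsetP sD p Dp; rewrite inE => /andP[_ /negbTE->].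
  by apply: f0; rewrite inE Dp.
apply/ffunP => -[i j]; rewrite !ffunE /=.
by case: eqP => // ->; rewrite f0 // !inE /= eqxx !andbF.
Qed.

Lemma index_vanish D : lower D -> #|[set: UT F R] : vanish D|%g = (#|F| ^ #|D|)%N.
Proof.
move=> lD; have [sD _] := lD; have := vanish_group_set lD => gD.
have -> : vanish D = Group gD by [].
rewrite -divgS ?subsetT //=.
have -> : [set: UT F R] = vanish set0.
  by apply/setP => u; rewrite inE; apply/esym/vanishP => p; rewrite inE.
rewrite !card_vanish ?sub0set // setD0 -expnB ?subset_leq_card ?subsetDl //.
  by rewrite cardsD (setIidPr sD) subKn ?subset_leq_card.
by apply/card_gt0P; exists 0.
Qed.

(** The elementary unitriangular matrix with entry [c] at [p]. For [p] in [Int0 R] the function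
    satisfies [UT_axiom]; where it does not, [insubd] falls back to the identity. *)
Definition elem p (c : F) : UT F R :=
  insubd (1%g : UT F R) [ffun r : T * T => (r.1 == r.2)%:R + c *+ (r == p)].

Lemma elemE p c r : p \in Int0 R -> elem p c r = (r.1 == r.2)%:R + c *+ (r == p).
Proof.
rewrite inE => /andP[Rp np]; rewrite /elem insubdK ?ffunE //.
apply: UT_axiomP => [i | i j nR]; rewrite ffunE /= -?pair_eqE /=.
  rewrite eqxx; case: andP => [[/eqP e1 /eqP e2] | _]; last by rewrite addr0.
  by rewrite -e1 -e2 eqxx in np.
have -> : (i == j) = false by apply: contraNF nR => /eqP->; rewrite po_refl.
case: andP => [[/eqP e1 /eqP e2] | _]; last by rewrite addr0.
by rewrite e1 e2 Rp in nR.
Qed.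

(** A row operation: [c] times row [p.2] is added to row [p.1]. Multiplication on the right is the
    corresponding column operation. *)
Lemma elem_mul p c u i k : p \in Int0 R ->
  (elem p c * u)%g (i, k) = u (i, k) + (c * u (p.2, k)) *+ (i == p.1).
Proof.
move=> p0; rewrite UT_mulE.
under eq_bigr => j _ do rewrite elemE //= mulrDl.
rewrite big_split /=; congr (_ + _).
  rewrite (bigD1 i) //= eqxx mul1r big1 ?addr0 // => j /negbTE nj.
  by rewrite eq_sym nj mul0r.
case: p {p0} => a b /=; rewrite (bigD1 b) //= xpair_eqE eqxx andbT mulrnAl.
rewrite big1 ?addr0 // => j /negbTE nj.
by rewrite xpair_eqE nj andbF mul0r.
Qed.

Lemma mul_elem p c u i k : p \in Int0 R ->
  (u * elem p c)%g (i, k) = u (i, k) + (u (i, p.1) * c) *+ (k == p.2).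
Proof.
move=> p0; rewrite UT_mulE.
under eq_bigr => j _ do rewrite elemE //= mulrDr.
rewrite big_split /=; congr (_ + _).
  rewrite (bigD1 k) //= eqxx mulr1 big1 ?addr0 // => j /negbTE nj.
  by rewrite nj mulr0.
case: p {p0} => a b /=; rewrite (bigD1 a) //= xpair_eqE eqxx mulrnAr.
rewrite big1 ?addr0 // => j /negbTE nj.
by rewrite xpair_eqE nj mulr0.
Qed.

(** * Correspondence between lower sets and normal pattern subgroups *)

Lemma elem_vanish D p : p \in Int0 R -> D \subset Int0 R ->
  (elem p 1 \in vanish D) = (p \notin D).
Proof.
move=> p0 sD; apply/vanishP/idP => [h | npD r Dr].
  apply/negP => /h; rewrite elemE // eqxx; move: p0; rewrite inE => /andP[_ /negbTE->].
  by rewrite add0r => /eqP; rewrite oner_eq0.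
rewrite elemE //; have := subsetP sD r Dr; rewrite inE => /andP[_ /negbTE->].
by case: eqP Dr npD => [-> -> // | _ _ _]; rewrite addr0.
Qed.

(** If [p] in [D'] is missing from [D], then [elem p 1] belongs to [vanish D] but not to
    [vanish D']. *)
Lemma vanishS D D' : D \subset Int0 R -> D' \subset Int0 R ->
  (vanish D \subset vanish D') = (D' \subset D).
Proof.
move=> sD sD'; apply/subsetP/subsetP => [h p D'p | h u /vanishP hu].
  have p0 := subsetP sD' p D'p; apply: contraLR (D'p) => npD.
  by rewrite -(elem_vanish p0) // h // elem_vanish.
by apply/vanishP => p /h /hu.
Qed.

Lemma vanish_proper D D' : D \subset Int0 R -> D' \subset Int0 R ->
  (vanish D \proper vanish D') = (D' \proper D).
Proof. by move=> sD sD'; rewrite !properE !vanishS. Qed.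


Lemma UT_sub_vanish (Q : porder T) : subposet Q R ->
  UT_sub F R Q = vanish (Int0 R :\: graph Q).
Proof.
move=> /forallP sQ; apply/setP => u; rewrite inE.
apply/idP/vanishP => [/andP[_ /forallP h] p | h].
  by rewrite inE => /andP[nQ _]; apply/eqP/(implyP (h p)); case: p nQ.
apply: UT_axiomP => [i | i j nQ]; first exact: UT_diag.
have [Rij | nR] := boolP (R i j); last exact: UT_out.
apply: h; rewrite !inE /= Rij /= -/(po_rel Q i j) nQ /=.
by apply: contraNneq nQ => ->; rewrite po_refl.
Qed.

(* Conjugating [elem (k, l) 1] by [elem (l, j) 1] produces a nonzero entry at
   [(k, j)], and symmetrically on the left. *)
Lemma NPttP (H : {set UT F R}) :
  reflect (exists2 D, lower D & H = vanish D) (H \in NPtt F R).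
Proof.
apply: (iffP imsetP) => [[Q] | [D lD ->]].
  rewrite inE => /andP[sQ nQ] ->; exists (Int0 R :\: graph Q); last first.
    exact: UT_sub_vanish.
  have sQR x y : Q x y -> R x y by apply/implyP/(forallP (forallP sQ x)).
  have [_ nrm] := fingroup.normalP nQ.
  have memQ x y : Q x y -> x != y -> elem (x, y) 1%R \in UT_sub F R Q.
    move=> Qxy nxy; have xy0 : (x, y) \in Int0 R by rewrite inE /= sQR.
    by rewrite UT_sub_vanish // elem_vanish ?subsetDl //
      !inE negb_and negbK /= -/(po_rel Q x y) Qxy.
  have outQ u x y : u \in UT_sub F R Q -> ~~ Q x y -> u (x, y) = 0.
    by rewrite inE => /andP[_ /forallP h] /(implyP (h (x, y)))/eqP.
  have conjQ u g : u \in UT_sub F R Q -> (u ^ g)%g \in UT_sub F R Q.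
    by move=> hu; rewrite -(nrm g (in_setT _)) memJ_conjg.
  (* Normality lets [elem (x, y) 1] move past [elem (y, z) 1], turning into some [h] in the
     subgroup. If [Q x z] failed, the entries at [(x, z)] of the two equal products would be 1 and
     0. *)
  have ext_r x y z : Q x y -> x != y -> R y z -> Q x z.
    move=> Qxy nxy Ryz; have [<- // | nyz] := eqVneq y z.
    apply: contraT => nQxz.
    have a0 : (x, y) \in Int0 R by rewrite inE /= sQR.
    have g0 : (y, z) \in Int0 R by rewrite inE /= Ryz.
    have nxz : (x == z) = false.
      by apply: contraNF nQxz => /eqP->; rewrite po_refl.
    have [h hQ /(congr1 (fun u : UT F R => u (x, z)))] :
        exists2 h, h \in UT_sub F R Q
          & (elem (x, y) 1%R * elem (y, z) 1%R = elem (y, z) 1%R * h)%g.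
      by exists (elem (x, y) 1%R ^ elem (y, z) 1%R)%g;
        rewrite ?conjQ ?memQ // -conjgC.
    rewrite mul_elem // elem_mul // (outQ h) //.
    rewrite !elemE //= !xpair_eqE !eqxx (negbTE nxy) nxz eq_sym (negbTE nyz) /=.
    by rewrite !addr0 !add0r mulr1 => /eqP; rewrite oner_eq0.
  have ext_l x y z : Q y z -> y != z -> R x y -> Q x z.
    move=> Qyz nyz Rxy; have [-> // | nxy] := eqVneq x y.
    apply: contraT => nQxz.
    have a0 : (y, z) \in Int0 R by rewrite inE /= sQR.
    have g0 : (x, y) \in Int0 R by rewrite inE /= Rxy.
    have nxz : (x == z) = false.
      by apply: contraNF nQxz => /eqP->; rewrite po_refl.
    have [h hQ /(congr1 (fun u : UT F R => u (x, z)))] :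
        exists2 h, h \in UT_sub F R Q
          & (elem (x, y) 1%R * elem (y, z) 1%R = h * elem (x, y) 1%R)%g.
      by exists (elem (y, z) 1%R ^ (elem (x, y) 1%R)^-1)%g;
        rewrite ?conjQ ?memQ // -conjgCV.
    rewrite elem_mul // mul_elem // (outQ h) //.
    rewrite !elemE //= !xpair_eqE !eqxx nxz (negbTE nxy) [z == y]eq_sym (negbTE nyz) /=.
    by rewrite !addr0 !add0r mul1r => /eqP; rewrite oner_eq0.
  split; first exact: subsetDl.
  move=> [k l] [i j] kl0; rewrite !inE /= => /and3P[nQ' Rij nij] /andP[/= ik lj].
  move: (kl0); rewrite inE /= => /andP[-> nkl]; rewrite nkl !andbT.
  apply: contra nQ' => Qkl; have Qkj : Q k j by apply: ext_r lj.
  (* The left extension needs k and j distinct; if they were equal, [R k l] and [R l j] would force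
     k = l. *)
  apply: (ext_l i k j) => //; apply: contra_neq nkl => kj.
  by apply: (@po_anti _ R); rewrite kj lj -kj sQR.
have [sD dD] := lD.
(* Deleting [D] from the graph of [R] leaves a partial order. For transitivity: if [(x, z)] were in
   [D] and x, y distinct, the smaller interval [(x, y)] would be in [D] as well. *)
pose r : rel T := fun x y => R x y && ((x, y) \notin D).
have D0 x y : (x, y) \in D -> R x y && (x != y).
  by move/(subsetP sD); rewrite inE.
have rr : reflexive r.
  by move=> x; rewrite /r po_refl; apply/negP => /D0; rewrite eqxx andbF.
have ra : antisymmetric r.
  by move=> x y /andP[/andP[xy _] /andP[yx _]]; apply: (@po_anti _ R); rewrite xy.
have rt : transitive r.
  move=> y x z /andP[xy nxy] /andP[yz nyz]; rewrite /r (po_trans xy yz) /=.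
  apply: contra nxy => xzD; have [xE | nexy] := eqVneq x y.
    by rewrite -xE xzD in nyz.
  apply: dD xzD _; first by rewrite inE /= xy.
  by rewrite /int_le /= po_refl.
set Q := porder_of rr ra rt.
have subQ : subposet Q R.
  by apply/forallP => x; apply/forallP => y; apply/implyP; rewrite porder_ofE => /andP[].
have eQ : UT_sub F R Q = vanish D.
  rewrite UT_sub_vanish //; congr vanish; apply/setP => -[x y].
  rewrite !inE /= /r negb_and negbK.
  case: (boolP ((x, y) \in D)) => [/D0 -> | _]; first by rewrite orbT.
  by rewrite orbF; case: (R x y).
exists Q; last by rewrite eQ.
by rewrite inE subQ eQ; apply: vanish_normal.
Qed.

Lemma lower_down lam : lower (down lam).
Proof.
split=> [|p r p0]; first by apply/subsetP => p; rewrite inE => /andP[].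
rewrite !inE => /andP[_ /existsP[q /andP[lq /andP[qr1 qr2]]]] /andP[pr1 pr2].
move: p0; rewrite inE => -> /=; apply/existsP; exists q; rewrite lq /int_le.
by rewrite (po_trans qr1 pr1) (po_trans pr2 qr2).
Qed.

Lemma int_le_trans : transitive (int_le R).
Proof.
by move=> q p r /andP[p1 p2] /andP[r1 r2]; rewrite /int_le (po_trans r1) ?(po_trans p2).
Qed.

Lemma int_le_anti : antisymmetric (int_le R).
Proof.
move=> [a b] [c d] /andP[/andP[/= ca bd] /andP[/= ac db]].
by congr (_, _); apply: (@po_anti _ R); apply/andP.
Qed.

Lemma int_le_refl : reflexive (int_le R).
Proof. by move=> p; rewrite /int_le !po_refl. Qed.

Lemma pp_nnP lam :
  reflect (lam \subset Int0 R /\ {in lam &, forall p r, int_le R p r -> p = r})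
          (lam \in pp_nn R).
Proof.
rewrite inE; apply: (iffP andP) => [[-> /forall_inP h] | [-> h]]; split=> //.
  by move=> p r lp lr ple; apply/eqP; apply: (implyP (forall_inP (h p lp) r lr)).
apply/forall_inP => p lp; apply/forall_inP => r lr; apply/implyP => le.
exact/eqP/h.
Qed.

Lemma downP lam p : reflect (p \in Int0 R /\ exists2 r, r \in lam & int_le R p r)
  (p \in down lam).
Proof. by apply: (iffP setIdP) => -[-> /exists_inP]. Qed.

(** * Covers of the subgroup attached to an antichain *)

Section Antichain.
Variable lam : {set T * T}.
Hypothesis lamP : lam \in pp_nn R.
Let L := down lam.

Lemma sub_down : lam \subset L.
Proof.
have [/subsetP s _] := pp_nnP _ lamP; apply/subsetP => p lp.
by apply/downP; split; [exact: s | exists p; rewrite ?int_le_refl].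
Qed.

Lemma down_max p r : p \in lam -> r \in L -> int_le R p r -> p = r.
Proof.
move=> lp /downP[r0 [q lq rq]] pr; have [_ anti] := pp_nnP _ lamP.
have pq := anti p q lp lq (int_le_trans pr rq); rewrite -pq in rq.
by apply: int_le_anti; rewrite pr.
Qed.

(** The elements of an antichain are maximal in the lower set it generates, so no remaining interval
    lies above a removed one. *)
Lemma lower_downD S : S \subset lam -> lower (L :\: S).
Proof.
move=> /subsetP sS; have [sL dL] := lower_down lam.
split=> [|p r p0]; first exact: subset_trans (subsetDl _ _) sL.
rewrite !(in_setD) => /andP[nSr Lr] pr; rewrite (dL p r) // andbT.
by apply: contra nSr => Sp; rewrite -(down_max (sS _ Sp) Lr pr).
Qed.

Lemma lower_downD1 s : s \in lam -> lower (L :\ s).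
Proof. by move=> ls; apply: lower_downD; rewrite sub1set. Qed.

(** A lower set [D] properly inside [L] misses some [s] in [lam], because [lam] generates [L]. Hence
    [vanish D] contains [vanish (L :\ s)], and minimality of a cover gives equality. Conversely,
    [L :\ s] is only one element smaller than [L], so nothing fits strictly between. *)
Lemma UT_lam_coverP (O : {set UT F R}) :
  reflect (exists2 s, s \in lam & O = vanish (L :\ s)) (NPtt_cover (UT_lam F R lam) O).
Proof.
have [sL dL] := lower_down lam; have sl := subsetP sub_down.
rewrite UT_lamE -/L; apply: (iffP and3P) => [[/NPttP[D [sD dD] ->] pLD min] | [s ls ->]].
  rewrite vanish_proper // properE in pLD; have /andP[sDL /subsetPn[p Lp nDp]] := pLD.
  have /downP[p0 [s ls ps]] := Lp; have nDs : s \notin D.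
    by apply: contra nDp => Ds; apply: dD Ds ps.
  exists s => //; have [s1 _] := lower_downD1 ls; apply/eqP; rewrite eqEsubset !vanishS //.
  have sDs : D \subset L :\ s by rewrite subsetD1 sDL.
  rewrite sDs andbT; move/forall_inP: min => /(_ (vanish (L :\ s))).
  rewrite !vanish_proper // properD1 ?sl // properE sDs /= negbK; apply.
  by apply/NPttP; exists (L :\ s) => //; apply: lower_downD1.
have [s1 d1] := lower_downD1 ls; split.
- by apply/NPttP; exists (L :\ s) => //; apply: lower_downD1.
- by rewrite vanish_proper // properD1 ?sl.
apply/forall_inP => K /NPttP[D [sD _] ->]; rewrite !vanish_proper //.
apply/andP => -[/proper_card c1 /proper_card c2].
by move: c1 c2; rewrite (cardsD1 s L) sl // add1n ltnS leqNgt => /negbTE->.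
Qed.

(* For [s] in [S], left multiplication by [elem s (- u s)] clears the entry of
   [u] at [s] and, [s] being maximal in [L], changes no other entry in [L]. *)
Lemma vanish_downD_sub (K : {group UT F R}) S : S \subset lam ->
  (vanish (L :\: S) \subset K) =
  (vanish L \subset K) && [forall s in S, vanish (L :\ s) \subset K].
Proof.
have [sL dL] := lower_down lam => sS; apply/idP/andP => [sK | [sLK /forall_inP sK]].
  split; first apply: subset_trans sK.
    by rewrite vanishS ?subsetDl //; have [] := lower_downD sS.
  apply/forall_inP => s Ss; apply: subset_trans sK.
  have [s1 _] := lower_downD1 (subsetP sS _ Ss); have [s2 _] := lower_downD sS.
  by rewrite vanishS // setDS // sub1set.
move: {2}#|_| (erefl #|S|) => n; elim: n S sS sK => [|n IHn] S sS sK.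
  by move/eqP; rewrite cards_eq0 => /eqP->; rewrite setD0.
move=> cS; have /card_gt0P[s Ss] : (0 < #|S|)%N by rewrite cS.
have ls := subsetP sS _ Ss; have [sl0 _] := pp_nnP _ lamP; have s0 := subsetP sl0 _ ls.
have {}IHn : vanish (L :\: (S :\ s)) \subset K.
  apply: IHn; first exact: subset_trans (subsetDl _ _) sS.
    by move=> r; rewrite inE => /andP[_]; apply: sK.
  by move: cS; rewrite (cardsD1 s) Ss => -[].
apply/subsetP => u /vanishP hu; set e := elem s (- u s).
have eK : e \in K.
  apply: (subsetP (sK s Ss)); apply/vanishP => r; rewrite in_setD1 => /andP[/negbTE nrs Lr].
  rewrite elemE // nrs addr0; have := subsetP sL _ Lr.
  by rewrite inE => /andP[_ /negbTE->].
rewrite -(groupMl u eK); apply: (subsetP IHn); apply/vanishP => -[k l].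
rewrite in_setD in_setD1 negb_and negbK => /andP[kS Lkl].
rewrite elem_mul //; have [es | nes] := eqVneq (k, l) s.
  by rewrite -es /= eqxx UT_diag mulr1 subrr.
have -> : u (k, l) = 0 by apply: hu; rewrite in_setD Lkl andbT; rewrite (negbTE nes) in kS.
rewrite add0r; case: eqP => [ks | //]; rewrite mulr1n.
suff nR : ~~ R s.2 l by rewrite (UT_out _ nR) mulr0.
apply: contra nes => sl; apply/eqP/esym; apply: down_max => //.
by rewrite /int_le /= -ks po_refl.
Qed.

End Antichain.
End PatternSubgroups.

(** * The product formula for [chi], and expansion of products over antichains *)

Lemma prodr_bool (K : comNzRingType) (I : finType) (A : {set I}) (b : pred I) :
  \prod_(i in A) (b i)%:R = [forall i in A, b i]%:R :> K.
Proof.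
case: (boolP [forall i in A, b i]) => [/forall_inP h | ].
  by rewrite big1 // => i /h ->.
by case/forall_inPn => i Ai /negbTE nb; rewrite (bigD1 i) //= nb mul0r.
Qed.

Lemma chiE (F : finFieldType) (T : finType) (R : porder T) (lam : {set T * T})
    (u : UT F R) : lam \in pp_nn R ->
  chi F R lam u =
  \prod_(p in down R lam) (#|F|%:R * (u p == 0)%:R - (p \in lam)%:R).
Proof.
move=> lamP; rewrite /chi sum_cfunE; set L := down R lam.
pose V (D : {set T * T}) : {set UT F R} := vanish F R D.
have condE (i : Iirr [set: UT F R]) :
    (UT_lam F R lam \subset cfker 'chi_i) &&
      [forall O : {set UT F R},
         NPtt_cover (UT_lam F R lam) O ==> ~~ (O \subset cfker 'chi_i)]
    = (V L \subset cfker 'chi_i) &&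
      [forall s in lam, ~~ (V (L :\ s) \subset cfker 'chi_i)].
  rewrite UT_lamE; congr (_ && _); apply/forall_inP/forall_inP => h.
    by move=> s ls; apply: h; rewrite -UT_lamE; apply/UT_lam_coverP => //; exists s.
  by move=> O; rewrite -UT_lamE => /(UT_lam_coverP lamP)[s ls ->]; apply: h.
(* Expand the product over [s] in [lam] of 1 minus the indicator that the kernel contains
   [V (L :\ s)]. By [vanish_downD_sub], the conditions for all [s] in [S] together with the one for
   [V L] say that the kernel contains [V (L :\: S)]. *)
have inclexcl (i : Iirr [set: UT F R]) :
    ((V L \subset cfker 'chi_i) &&
      [forall s in lam, ~~ (V (L :\ s) \subset cfker 'chi_i)])%:R
    = \sum_(S : {set T * T} | S \subset lam)
        (-1) ^+ #|S| * (V (L :\: S) \subset cfker 'chi_i)%:R :> algC.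
  rewrite -mulnb natrM -prodr_bool.
  rewrite (eq_bigr (fun s => - (V (L :\ s) \subset cfker 'chi_i)%:R + 1)); last first.
    by move=> s _; case: (_ \subset _); rewrite ?addNr // oppr0 add0r.
  rewrite prodrD_subset big_distrr /=; apply: eq_bigr => S sS.
  rewrite big1_eq mulr1 prodrN prodr_bool mulrCA -natrM mulnb.
  by rewrite /V -vanish_downD_sub.
rewrite (eq_bigl _ _ condE) big_mkcond /=.
(* For fixed [S], [sum_irr_cfker] yields the index of [V (L :\: S)] times its indicator. The index
   is a power of q with exponent the size of [L :\: S], so both factors are products over
   [L :\: S]. *)
transitivity (\sum_(S : {set T * T} | S \subset lam)
   (-1) ^+ #|S| * \prod_(p in L :\: S) (#|F|%:R * (u p == 0)%:R : algC)).
  under eq_bigr => i _ do rewrite -mulrb -mulr_natl inclexcl big_distrl /=.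
  rewrite exchange_big /=; apply: eq_bigr => S sS; have lS := lower_downD lamP sS.
  under eq_bigr => i _ do rewrite -mulrA; rewrite -big_distrr /=; congr (_ * _).
  pose N := Group (vanish_group_set F lS).
  have nN : (N <| [set: UT F R])%g by apply: vanish_normal.
  transitivity (#|F|%:R ^+ #|L :\: S| * (u \in V (L :\: S))%:R : algC); last first.
    by rewrite big_split /= prodr_const prodr_bool /V inE.
  rewrite -natrX -(index_vanish F lS).
  have /cfunP/(_ u) := sum_irr_cfker nN.
  rewrite sum_cfunE !cfunE cfuniE // => <-; rewrite [RHS]big_mkcond /=.
  by apply: eq_bigr => i _; rewrite mulr_natl mulrb.
(* The alternating sum is the expansion of the claimed product: [S] records where the term
   [- (p \in lam)] is chosen, and a choice outside [lam] contributes 0. *)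
rewrite [RHS](eq_bigr (fun p => - (p \in lam)%:R + #|F|%:R * (u p == 0)%:R)); last first.
  by move=> p _; rewrite addrC.
rewrite prodrD_subset [RHS](bigID (fun S : {set T * T} => S \subset lam)) /=.
rewrite [X in _ + X]big1 ?addr0 => [|S /andP[_ /subsetPn[x Sx nx]]]; last first.
  by rewrite (bigD1 x) //= (negbTE nx) oppr0 !mul0r.
apply: eq_big => [S | S sS].
  by case: (boolP (S \subset lam)) => [sS|]; rewrite ?andbF //
    (subset_trans sS (sub_down lamP)).
congr (_ * _); rewrite prodrN prodr_bool; suff -> : [forall i in S, i \in lam] by rewrite mulr1.
by apply/forall_inP/subsetP.
Qed.

(* Expand [f p = (f p - 1) + 1] and group the subsets of [Q] by their sets of
   maximal elements: those with maximal elements [nu] lie between [nu] and the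
   lower set of [Q] that [nu] generates. *)
Lemma prod_sum_Anti (K : comNzRingType) (I : finType) (le : rel I) (Q : {set I})
    (f : I -> K) :
  reflexive le -> antisymmetric le -> transitive le ->
  \prod_(p in Q) f p =
  \sum_(nu in Anti le Q)
    \prod_(p in [set p in Q | [exists r in nu, le p r]]) (f p - (p \in nu)%:R).
Proof.
move=> rr ra rt.
pose mx (X : {set I}) := [set p in X | [forall r in X, le p r ==> (p == r)]].
have mxP (X : {set I}) p : p \in X -> exists2 r, r \in mx X & le p r.
  move=> Xp; have P0 : (p \in X) && le p p by rewrite Xp rr.
  (* A maximal element of [X] above [p] is found by maximizing the number of elements below it. *)
  case: (@arg_maxnP _ p (fun r => (r \in X) && le p r) (fun r => #|[set s | le s r]|) P0).
  move=> r /andP[Xr pr] max; exists r => //; rewrite inE Xr; apply/forall_inP => s Xs.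
  apply/implyP => rs; have := max s; rewrite Xs (rt _ _ _ pr rs) => /(_ isT) /=.
  rewrite leqNgt; apply: contraR => nrs; apply: proper_card; apply/properP; split.
    by apply/subsetP => t; rewrite !inE => tr; apply: rt rs.
  exists s; rewrite !inE ?rr //; apply: contra nrs => sr.
  by apply/eqP/ra; rewrite rs.
rewrite (eq_bigr (fun p => (f p - 1) + 1)); last by move=> p _; rewrite subrK.
rewrite prodrD_subset (eq_bigr (fun X : {set I} => \prod_(p in X) (f p - 1))); last first.
  by move=> X _; rewrite big1_eq mulr1.
rewrite (partition_big mx (mem (Anti le Q))) /=; last first.
  move=> X sX; rewrite inE (subset_trans _ sX) /=; last first.
    by apply/subsetP => p; rewrite inE => /andP[].
  apply/forall_inP => p; rewrite inE => /andP[_ /forall_inP h].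
  by apply/forall_inP => r; rewrite inE => /andP[Xr _]; apply: h.
apply: eq_bigr => nu; rewrite inE => /andP[/subsetP sQ /forall_inP anti].
set D := [set p in Q | _].
(* In this form the second summand is 0 on [nu] and 1 elsewhere, so the expansion keeps exactly the
   subsets containing [nu]. *)
rewrite [RHS](eq_bigr (fun p => (f p - 1) + (p \notin nu)%:R)); last first.
  by move=> p _; case: (p \in nu); rewrite ?addr0 // subr0 subrK.
rewrite prodrD_subset [RHS](bigID (fun X : {set I} => nu \subset X)) /=.
rewrite [X in _ + X]big1 ?addr0 => [|X /andP[_ /subsetPn[x nux nx]]]; last first.
  have xD : x \in D :\: X.
    by rewrite inE nx inE sQ //=; apply/exists_inP; exists x.
  by rewrite [X in _ * X](bigD1 x) //= nux mul0r mulr0.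
apply: eq_big => [X | X /andP[sX /eqP mxX]]; last first.
  rewrite [X in _ * X]big1 ?mulr1 // => p; rewrite inE => /andP[nXp _].
  suff -> : p \notin nu by [].
  by apply: contra nXp; rewrite -mxX inE => /andP[].
apply/andP/andP => [[/subsetP sX /eqP mxX] | [/subsetP sX /subsetP nuX]].
  split; apply/subsetP => p; last by rewrite -mxX inE => /andP[].
  move=> Xp; rewrite inE sX //=; have [r] := mxP X p Xp; rewrite mxX => nur pr.
  by apply/exists_inP; exists r.
split; first by apply/subsetP => p /sX; rewrite inE => /andP[].
rewrite eqEsubset; apply/andP; split; apply/subsetP => p.
  rewrite inE => /andP[Xp /forall_inP max].
  have := sX p Xp; rewrite inE => /andP[_ /exists_inP[r nur pr]].
  by have /implyP/(_ pr)/eqP-> := max r (nuX r nur).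
move=> nup; rewrite inE nuX //=; apply/forall_inP => r Xr; apply/implyP => pr.
have := sX r Xr; rewrite inE => /andP[_ /exists_inP[s nus rs]].
have /forall_inP/(_ s nus)/implyP/(_ (rt _ _ _ pr rs))/eqP ps := anti p nup.
by apply/eqP/ra; rewrite pr ps rs.
Qed.

(** * Lower sets containing an antichain: sums over its extensions, and degree ratios *)

Section BetweenIdeals.
Variables (F : finFieldType) (T : finType) (R : porder T) (lam J : {set T * T}).
Hypotheses (lamP : lam \in pp_nn R) (lowJ : lower R J) (lamJ : lam \subset J).

Lemma down_sub_lower : down R lam \subset J.
Proof.
have [_ dJ] := lowJ; apply/subsetP => p /downP[p0 [r lr pr]].
exact: dJ (subsetP lamJ _ lr) pr.
Qed.

Lemma prod_setD_down (K : comNzRingType) (f : T * T -> K) :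
  \prod_(p in J) (f p - (p \in lam)%:R) =
  \prod_(p in down R lam) (f p - (p \in lam)%:R) * \prod_(p in J :\: down R lam) f p.
Proof.
rewrite (big_setID (down R lam)) /= (setIidPr down_sub_lower); congr (_ * _).
apply: eq_bigr => p; rewrite in_setD => /andP[ndp _].
by rewrite (contraNF (subsetP (sub_down lamP) p) ndp) subr0.
Qed.

(** Maximality of [lam] in [J] makes every [lam :|: nu] an antichain. The lower set it generates is
    [down R lam] together with the part of [J :\: down R lam] below [nu]. Each summand is thus a
    common product over [down R lam] times one term of [prod_sum_Anti]. *)
Lemma sum_chi_Anti (u : UT F R) :
  (forall p r, p \in lam -> r \in J -> int_le R p r -> p = r) ->
  \sum_(nu in Anti (int_le R) (J :\: down R lam)) chi F R (lam :|: nu) u =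
  \prod_(p in J) (#|F|%:R * (u p == 0)%:R - (p \in lam)%:R).
Proof.
move=> maxJ; have [/subsetP J0 dJ] := lowJ.
have [/subsetP lam0 lanti] := pp_nnP _ _ lamP.
rewrite (prod_setD_down (fun p => #|F|%:R * (u p == 0)%:R)).
rewrite (prod_sum_Anti (J :\: down R lam) _ (@int_le_refl _ R) (@int_le_anti _ R)
          (@int_le_trans _ R)) big_distrr /=.
apply: eq_bigr => nu; rewrite inE => /andP[/subsetP nuQ /forall_inP nuanti].
have nuJ p : p \in nu -> p \in J /\ p \notin down R lam.
  by move/nuQ; rewrite in_setD => /andP[].
have lnP : lam :|: nu \in pp_nn R.
  apply/pp_nnP; split.
    by apply/subsetP => p; rewrite inE => /orP[/lam0 | /nuJ[/J0]].
  move=> p r; rewrite !inE => /orP[lp | np] /orP[lr | nr] pr.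
  - exact: lanti.
  - by apply: maxJ => //; case: (nuJ r nr).
  - have [/J0 p0 /negP[]] := nuJ p np; apply/downP; split=> //; by exists r.
  - exact/eqP/(implyP (forall_inP (nuanti p np) r nr)).
rewrite chiE // (big_setID (down R lam)) /=.
have -> : down R (lam :|: nu) :&: down R lam = down R lam.
  apply/setIidPr/subsetP => p /downP[p0 [r lr pr]]; apply/downP; split=> //.
  by exists r; rewrite // inE lr.
congr (_ * _).
  apply: eq_bigr => p dp; rewrite inE orbC.
  by case: (boolP (p \in nu)) => [/nuJ[_] | //]; rewrite dp.
apply: eq_big => [p | p].
  apply/setDP/setIdP => [[/downP[p0 [r]]] | [/setDP[Jp nd] /exists_inP[r nur pr]]].
    rewrite inE => /orP[lr | nur] pr nd.
      by case/negP: nd; apply/downP; split=> //; exists r.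
    split; last by apply/exists_inP; exists r.
    by apply/setDP; split=> //; apply: dJ p0 (proj1 (nuJ r nur)) pr.
  by split=> //; apply/downP; split; [exact: J0 | exists r; rewrite // inE nur orbT].
case/setDP => _ nd; rewrite inE.
by rewrite (contraNF (subsetP (sub_down lamP) p) nd).
Qed.

Let q : algC := #|F|%:R.

Lemma card_field_neq0 : q != 0.
Proof. by rewrite pnatr_eq0 -lt0n; apply/card_gt0P; exists 0. Qed.

Lemma card_field_neq1 : q - 1 != 0.
Proof. by rewrite subr_eq0 pnatr_eq1 neq_ltn card_finNzRing_gt1 orbT. Qed.

Lemma chi1_neq0 : \prod_(p in down R lam) (q - (p \in lam)%:R) != 0.
Proof.
apply/prodf_neq0 => p _; case: (p \in lam); rewrite ?subr0 ?card_field_neq0 //.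
exact: card_field_neq1.
Qed.

(** On [J :\: down R lam] every factor of the product is q. The quotient of products is therefore q
    to the size of that difference, and the quotient of orders is its inverse. This cancels the
    normalizing constant in the restriction formula. *)
Lemma card_vanish_ratio :
  #|vanish F R J|%:R / #|vanish F R (down R lam)|%:R
    * ((\prod_(p in J) (q - (p \in lam)%:R))
       / \prod_(p in down R lam) (q - (p \in lam)%:R)) = 1.
Proof.
have [sJ _] := lowJ; have [sD _] := lower_down R lam.
rewrite (prod_setD_down (fun=> q)) [_ * \prod_(p in J :\: _) _]mulrC mulfK ?chi1_neq0 // prodr_const.
have -> : #|vanish F R (down R lam)| = (#|vanish F R J| * #|F| ^ #|J :\: down R lam|)%N.
  rewrite !card_vanish // -expnD; congr (_ ^ _)%N.
  rewrite !cardsD (setIidPr sJ) (setIidPr sD) (setIidPr down_sub_lower).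
  by rewrite addnBA ?subnK ?subset_leq_card ?down_sub_lower.
rewrite natrM natrX invfM mulrA mulfV ?mul1r ?mulVf ?expf_neq0 ?card_field_neq0 //.
by rewrite pnatr_eq0 card_vanish // -lt0n expn_gt0 lt0n -(pnatr_eq0 algC) card_field_neq0.
Qed.

End BetweenIdeals.

(** * Restriction of an order along an injection, used for both A and B *)

Section Pullback.
Variables (F : finFieldType) (S T : finType) (f : S -> T) (injf : injective f).
Variables (R : porder T) (lam : {set T * T}).
Hypothesis lamP : lam \in pp_nn R.

Let f2 (p : S * S) : T * T := (f p.1, f p.2).
Let R' := pullback injf R.
Let lam' := f2 @^-1: lam.
(** It can be strictly larger than [down R' lam'], since an interval of [S] may lie below an element
    of [lam] whose endpoints are not both in the image of [f]. *)
Let J := f2 @^-1: down R lam.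

Lemma pullback_Int0 p : (p \in Int0 R') = (f2 p \in Int0 R).
Proof. by rewrite !inE porder_ofE (inj_eq injf). Qed.

Lemma pullback_int_le p r : int_le R' p r = int_le R (f2 p) (f2 r).
Proof. by rewrite /int_le !porder_ofE. Qed.

Lemma pullback_pp_nn : lam' \in pp_nn R'.
Proof.
have [/subsetP l0 anti] := pp_nnP _ _ lamP; apply/pp_nnP; split.
  by apply/subsetP => p; rewrite pullback_Int0 inE => /l0.
move=> p r; rewrite !inE pullback_int_le => lp lr pr.
by case: p r lp lr pr => a b [c d] lp lr /(anti _ _ lp lr)[/injf-> /injf->].
Qed.

Lemma pullback_lower : lower R' J.
Proof.
have [/subsetP sL dL] := lower_down R lam; split.
  by apply/subsetP => p; rewrite inE pullback_Int0 => /sL.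
move=> p r; rewrite pullback_Int0 pullback_int_le [r \in J]inE => p0 Lr pr.
by rewrite inE; apply: dL Lr pr.
Qed.

Lemma pullback_sub : lam' \subset J.
Proof. by apply/preimsetS/sub_down. Qed.

(** Identifies the difference indexing the antichains in [sum_chi_Anti] with [IntA] and [IntB]. *)
Lemma setD_down_pullback :
  J :\: down R' lam' =
  [set p in Int0 R' | [forall r in lam', ~~ int_le R' p r]
                      && [exists r in lam, int_le R (f2 p) r]].
Proof.
apply/setP => p.
have dR : (p \in J) = (p \in Int0 R') && [exists r in lam, int_le R (f2 p) r].
  by rewrite pullback_Int0 in_set [LHS]in_set.
have dR' : (p \in down R' lam') = (p \in Int0 R') && [exists r in lam', int_le R' p r].
  by rewrite [LHS]in_set.
rewrite in_setD dR dR' [RHS]in_set.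
by case: (p \in Int0 R'); rewrite ?andbF //= negb_exists_in.
Qed.

Lemma sum_chi_pullback (u : UT F R') :
  \sum_(nu in Anti (int_le R') (J :\: down R' lam')) chi F R' (lam' :|: nu) u =
  \prod_(p in J) (#|F|%:R * (u p == 0)%:R - (p \in lam')%:R).
Proof.
apply: sum_chi_Anti; [exact: pullback_pp_nn | exact: pullback_lower | exact: pullback_sub |].
(* [lam'] is maximal in [J] because [lam] is maximal in [down R lam] and [f] is injective. *)
move=> p r; rewrite pullback_int_le inE [r \in J]inE => lp Lr.
by case: p r lp Lr => a b [c d] lp Lr /(down_max lamP lp Lr)[/injf-> /injf->].
Qed.

End Pullback.

(** * Antichains and product formulas on a union of two posets *)

Section UnionProducts.
Variables (A B : finType).

Lemma inl2_inj : injective (@inl2 A B).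
Proof. by move=> [a b] [c d] [-> ->]. Qed.

Lemma inr2_inj : injective (@inr2 A B).
Proof. by move=> [a b] [c d] [-> ->]. Qed.

Lemma mem_unionAB_inl (X : {set A * A}) (Y : {set B * B}) p :
  (inl2 B p \in unionAB X Y) = (p \in X).
Proof.
rewrite inE mem_imset; last exact: inl2_inj.
by rewrite orbC; case: imsetP => // -[].
Qed.

Lemma mem_unionAB_inr (X : {set A * A}) (Y : {set B * B}) p :
  (inr2 A p \in unionAB X Y) = (p \in Y).
Proof.
rewrite inE mem_imset; last exact: inr2_inj.
by case: imsetP => // -[].
Qed.

Lemma unionABP (X : {set A * A}) (Y : {set B * B}) p :
  reflect ((exists2 a, a \in X & p = inl2 B a) \/ (exists2 b, b \in Y & p = inr2 A b))
          (p \in unionAB X Y).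
Proof.
by rewrite inE; apply: (iffP orP) => -[] h; [left|right|left|right]; apply/imsetP.
Qed.

Lemma prod_unionAB (K : comNzRingType) (X : {set A * A}) (Y : {set B * B})
    (g : (A + B) * (A + B) -> K) :
  \prod_(p in unionAB X Y) g p =
  (\prod_(p in X) g (inl2 B p)) * \prod_(p in Y) g (inr2 A p).
Proof.
have dis : [disjoint @inl2 A B @: X & @inr2 A B @: Y].
  rewrite disjoints_subset; apply/subsetP => _ /imsetP[a _ ->].
  by rewrite inE; apply/imsetP => -[].
rewrite (eq_bigl _ _ (fun p => in_setU p _ _)) (bigU _ _ _ dis) /=.
by rewrite !big_imset //= => x y _ _; [apply: inr2_inj | apply: inl2_inj].
Qed.

Section UnionOrder.
Variables (b : bool) (P : porder A) (Q : porder B) (lam : {set A * A}) (nu : {set B * B}).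
Let U : porder (A + B)%type := union_porder b P Q.

Lemma int_le_inl p r : int_le U (inl2 B p) (inl2 B r) = int_le P p r.
Proof. by rewrite /int_le !porder_ofE. Qed.

Lemma int_le_inr p r : int_le U (inr2 A p) (inr2 A r) = int_le Q p r.
Proof. by rewrite /int_le !porder_ofE. Qed.

Lemma Int0_inl p : (inl2 B p \in Int0 U) = (p \in Int0 P).
Proof. by rewrite !inE porder_ofE. Qed.

Lemma Int0_inr p : (inr2 A p \in Int0 U) = (p \in Int0 Q).
Proof. by rewrite !inE porder_ofE. Qed.

Lemma union_pp_nn : lam \in pp_nn P -> nu \in pp_nn Q -> unionAB lam nu \in pp_nn U.
Proof.
move=> /pp_nnP[/subsetP l0 la] /pp_nnP[/subsetP n0 na]; apply/pp_nnP; split.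
  apply/subsetP => p /unionABP[[a /l0 h ->]|[c /n0 h ->]].
    by rewrite Int0_inl.
  by rewrite Int0_inr.
move=> p r /unionABP[[a ha ->]|[c hc ->]] /unionABP[[a' ha' ->]|[c' hc' ->]].
- by rewrite int_le_inl => /(la _ _ ha ha') ->.
- by rewrite /int_le !porder_ofE.
- by rewrite /int_le !porder_ofE andbF.
- by rewrite int_le_inr => /(na _ _ hc hc') ->.
Qed.

(** An interval below one inside A has its right end in A, hence its left end too, as no element of
    B precedes one of A; dually for B. So no mixed interval occurs, whatever [b] is, and the
    concatenation and the disjoint union are handled together. *)
Lemma down_union : down U (unionAB lam nu) = unionAB (down P lam) (down Q nu).
Proof.
apply/setP => p; apply/downP/unionABP => [[p0 [r]] | ].
  case/unionABP => -[a ha ->]; case: p p0 => -[x|x] [y|y];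
    rewrite [_ \in Int0 _]inE /int_le !porder_ofE //= ?andbF //.
  - move=> p0 /andP[ax ya]; left; exists (x, y) => //.
    by apply/downP; split; [rewrite inE | exists a; rewrite // /int_le ax].
  - move=> p0 /andP[ax ya]; right; exists (x, y) => //.
    by apply/downP; split; [rewrite inE | exists a; rewrite // /int_le ax].
case=> -[a /downP[a0 [r hr ar]] ->].
  by rewrite Int0_inl; split=> //; exists (inl2 B r); rewrite ?mem_unionAB_inl ?int_le_inl.
by rewrite Int0_inr; split=> //; exists (inr2 A r); rewrite ?mem_unionAB_inr ?int_le_inr.
Qed.

Lemma chi_union (F : finFieldType) (u : UT F U) :
  lam \in pp_nn P -> nu \in pp_nn Q ->
  chi F U (unionAB lam nu) u =
  (\prod_(p in down P lam) (#|F|%:R * (u (inl2 B p) == 0)%:R - (p \in lam)%:R))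
  * \prod_(p in down Q nu) (#|F|%:R * (u (inr2 A p) == 0)%:R - (p \in nu)%:R).
Proof.
move=> lP nP; rewrite chiE ?union_pp_nn // down_union prod_unionAB.
by congr (_ * _); apply: eq_bigr => p _; rewrite ?mem_unionAB_inl ?mem_unionAB_inr.
Qed.

End UnionOrder.
End UnionProducts.

Lemma UT_1_Int0 (F : finFieldType) (T : finType) (R : porder T) p :
  p \in Int0 R -> (1%g : UT F R) p = 0.
Proof. by case: p => i j; rewrite inE UT_1E => /andP[_ /negbTE->]. Qed.

(** * The embedding of the product of the two restricted pattern groups *)

Section Iota.
Variables (F : finFieldType) (A B : finType) (R : porder (A + B)%type).
Implicit Type uv : UT F (resA R) * UT F (resB R).

Lemma iota_inl uv p : iotaAB uv (inl2 B p) = uv.1 p.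
Proof. by rewrite ffunE; case: p. Qed.

Lemma iota_inr uv p : iotaAB uv (inr2 A p) = uv.2 p.
Proof. by rewrite ffunE; case: p. Qed.

Lemma iotaAB_inj : injective (@iotaAB F A B R).
Proof.
move=> [u v] [u' v'] e; congr (_, _); apply: UT_eqP => i j _.
  by have := iota_inl (u, v) (i, j); rewrite e iota_inl.
by have := iota_inr (u, v) (i, j); rewrite e iota_inr.
Qed.

(** Mixed entries of an embedded pair are 0 already, so only the intervals of [D] inside A or inside
    B impose conditions, one component each. *)
Lemma card_vanish_iota (D : {set (A + B) * (A + B)}) :
  #|vanish F R D :&: [set iotaAB uv | uv : UT F (resA R) * UT F (resB R)]|
  = (#|vanish F (resA R) (lamA D)| * #|vanish F (resB R) (lamB D)|)%N.
Proof.
rewrite -cardsX -(card_imset _ iotaAB_inj); apply: eq_card => w.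
apply/setIP/imsetP => [[/vanishP wD /imsetP[uv _ e]] | [[u v] /setXP[uD vD] ->]].
  exists uv => //; case: uv e => u v e; rewrite {w}e in wD.
  apply/setXP; split; apply/vanishP => p; rewrite inE => /wD.
    by rewrite (iota_inl (u, v)).
  by rewrite (iota_inr (u, v)).
split; last exact: imset_f.
apply/vanishP => -[[i|i] [j|j]] Dp; rewrite ffunE //=.
  by move/vanishP: uD; apply; rewrite inE.
by move/vanishP: vD; apply; rewrite inE.
Qed.

End Iota.

(** * Inflation to a concatenation and restriction to a product *)

Theorem theorem4p6 (F : finFieldType) (A B : finType) :
  (forall (R : porder A) (Q : porder B)
          (lam : {set A * A}) (nu : {set B * B}),
      lam \in pp_nn R -> nu \in pp_nn Q ->
      unionAB lam nu \in pp_nn (concat R Q) /\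
      Inf (tens (chi F R lam) (chi F Q nu))
        =1 chi F (concat R Q) (unionAB lam nu))
  /\
  (forall (R : porder (A + B)%type) (lam : {set (A + B) * (A + B)}),
      lam \in pp_nn R ->
      Res (chi F R lam) =1 (fun uv : UT F (resA R) * UT F (resB R) =>
        #|UT_lam F R lam :&: [set iotaAB p | p : UT F (resA R) * UT F (resB R)]|%:R
        / #|setX (UT_lam F (resA R) (lamA lam)) (UT_lam F (resB R) (lamB lam))|%:R
        * (chi F R lam 1%g
           / chi F (disj (resA R) (resB R)) (unionAB (lamA lam) (lamB lam)) 1%g)
        * \sum_(nu in Anti (int_le (resA R)) (IntA R lam))
            \sum_(eta in Anti (int_le (resB R)) (IntB R lam))
              tens (chi F (resA R) (lamA lam :|: nu))
                   (chi F (resB R) (lamB lam :|: eta)) uv)).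
Proof.
split=> [R Q lam nu lP nP | R lam lP [u v]].
  split; first exact: union_pp_nn.
  move=> u; rewrite /Inf /tens /= chi_union // !chiE //.
  by congr (_ * _); apply: eq_bigr => p _; rewrite ffunE.
pose q : algC := #|F|%:R; set L := down R lam; set w := iotaAB (u, v).
(* The factors of the product formula for [lam] split by position: [PA] and [PB] over the intervals
   of [L] inside A and B, [C] over the mixed ones. The index set [lamA L] may exceed the lower set
   generated by [lamA lam]. *)
pose PA (x : UT F (resA R)) :=
  \prod_(p in lamA L) (q * (x p == 0)%:R - (p \in lamA lam)%:R).
pose PB (x : UT F (resB R)) :=
  \prod_(p in lamB L) (q * (x p == 0)%:R - (p \in lamB lam)%:R).
pose C := \prod_(p in L :\: unionAB (lamA L) (lamB L)) (q - (p \in lam)%:R).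
have lAP : lamA lam \in pp_nn (resA R) := pullback_pp_nn _ lP.
have lBP : lamB lam \in pp_nn (resB R) := pullback_pp_nn _ lP.
(* Stated for any [x] with zero mixed entries in [L], so as to apply both to the embedded pair and
   to the identity. *)
have split_chi (x : UT F R) (a : UT F (resA R)) (b : UT F (resB R)) :
    (forall p, x (inl2 B p) = a p) -> (forall p, x (inr2 A p) = b p) ->
    {in L :\: unionAB (lamA L) (lamB L), forall p, x p = 0} ->
    chi F R lam x = PA a * PB b * C.
  move=> xa xb x0; rewrite chiE // -/L (big_setID (unionAB (lamA L) (lamB L))) /=.
  congr (_ * _); last by apply: eq_bigr => p /x0 ->; rewrite eqxx mulr1.
  rewrite (setIidPr _); last first.
    by apply/subsetP => p /unionABP[] -[r]; rewrite inE => ? ->.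
  rewrite prod_unionAB; congr (_ * _); apply: eq_bigr => p _.
    by rewrite xa [p \in lamA _]inE.
  by rewrite xb [p \in lamB _]inE.
have mixed p : p \in L :\: unionAB (lamA L) (lamB L) -> w p = 0.
  rewrite in_setD => /andP[nU Lp]; rewrite ffunE.
  case: p nU Lp => [[i|i] [j|j]] // nU Lp; case/negP: nU.
    by rewrite (mem_unionAB_inl _ _ (i, j)) inE.
  by rewrite (mem_unionAB_inr _ _ (i, j)) inE.
have resE : Res (chi F R lam) (u, v) = PA u * PB v * C.
  by apply: split_chi => // p; rewrite ?iota_inl ?iota_inr.
have deg1 : chi F R lam 1%g = PA 1%g * PB 1%g * C.
  apply: split_chi => [[i j] | [i j] | p]; rewrite ?UT_1E //.
  rewrite in_setD => /andP[_ Lp]; apply: UT_1_Int0.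
  by have [/subsetP/(_ _ Lp)] := lower_down R lam.
have sumA : \sum_(nu in Anti (int_le (resA R)) (IntA R lam))
    chi F (resA R) (lamA lam :|: nu) u = PA u.
  have := sum_chi_pullback (injf := @inl_injective A B) lP u.
  rewrite setD_down_pullback; exact.
have sumB : \sum_(nu in Anti (int_le (resB R)) (IntB R lam))
    chi F (resB R) (lamB lam :|: nu) v = PB v.
  have := sum_chi_pullback (injf := @inr_injective A B) lP v.
  rewrite setD_down_pullback; exact.
(* [DA] and [DB] are the degrees of the supercharacters of [lamA lam] and [lamB lam]; their product
   is the degree in the denominator. *)
pose DA := \prod_(p in down (resA R) (lamA lam)) (q - (p \in lamA lam)%:R).
pose DB := \prod_(p in down (resB R) (lamB lam)) (q - (p \in lamB lam)%:R).
have ddeg1 : chi F (disj (resA R) (resB R)) (unionAB (lamA lam) (lamB lam)) 1%g = DA * DB.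
  rewrite chi_union //; congr (_ * _); apply: eq_bigr => p dp.
    by rewrite UT_1_Int0 ?Int0_inl ?eqxx ?mulr1 //; case/downP: dp.
  by rewrite UT_1_Int0 ?Int0_inr ?eqxx ?mulr1 //; case/downP: dp.
have oneA : PA 1%g = \prod_(p in lamA L) (q - (p \in lamA lam)%:R).
  apply: eq_bigr => p Lp; rewrite UT_1_Int0 ?eqxx ?mulr1 //.
  by have [/subsetP/(_ _ Lp)] := pullback_lower (@inl_injective A B) R lam.
have ratioA : #|vanish F (resA R) (lamA L)|%:R
    / #|vanish F (resA R) (down (resA R) (lamA lam))|%:R * (PA 1%g / DA) = 1.
  by rewrite oneA;
    apply: etrans (card_vanish_ratio F lAP (pullback_lower _ R lam) (pullback_sub _ lP)) _.
have oneB : PB 1%g = \prod_(p in lamB L) (q - (p \in lamB lam)%:R).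
  apply: eq_bigr => p Lp; rewrite UT_1_Int0 ?eqxx ?mulr1 //.
  by have [/subsetP/(_ _ Lp)] := pullback_lower (@inr_injective A B) R lam.
have ratioB : #|vanish F (resB R) (lamB L)|%:R
    / #|vanish F (resB R) (down (resB R) (lamB lam))|%:R * (PB 1%g / DB) = 1.
  by rewrite oneB;
    apply: etrans (card_vanish_ratio F lBP (pullback_lower _ R lam) (pullback_sub _ lP)) _.
(* The double sum is [PA u * PB v]. By [ratioA] and [ratioB] the order and degree quotients cancel
   separately on A and on B, so the constant in front reduces to [C]. *)
rewrite resE deg1 ddeg1 !UT_lamE card_vanish_iota cardsX -/L.
rewrite [X in _ = _ * X](_ : _ = PA u * PB v); last first.
  by rewrite -sumA -sumB big_distrlr.
rewrite [LHS]mulrC; congr (_ * _); rewrite !natrM [_ * C / _]mulrAC -!mulf_div.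
by rewrite [RHS]mulrA [X in X * C]mulrACA ratioA ratioB !mul1r.
Qed.
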